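(* Let $A:X=\ell^2\to Y$, $y$, $x^\dagger$ and $\mathcal R$ satisfy the following. (1) $A$ is an injective bounded linear operator from $\ell^2$ to the infinite dimensional Banach space $Y$ with adjoint $A^*:Y^*\to \ell^2$, and the range of $A$ is not closed in $Y$. We have $y\in{\rm Range}(A)$, and the unique solution $x^\dagger$ of $Ax=y$ lies in $\ell^0$, with non-empty finite support $I=\{i\in\mathbb N: x_i^\dagger\ne 0\}$. The functional $\mathcal R:\ell^2\to[0,\infty]$ is proper, convex, lower semi-continuous and stabilizing, i.e. all sublevel sets $\{x\in \ell^2:\mathcal R(x)\le c\}$, $c\ge 0$, are weakly sequentially pre-compact in $\ell^2$. (2) For every $i\in\mathbb N$ there exists $\omega_i\in Y^*$ with $e^{(i)}=A^*\omega_i$. (3) $x^\dagger\in\mathcal D(\mathcal R)$ and $\partial\mathcal R(x^\dagger)\ne\emptyset$, but the source condition fails: no element of $\partial\mathcal R(x^\dagger)$ is of the form $A^*w$ with $w\in Y^*$. Let $\xi^\dagger\in\partial\mathcal R(x^\dagger)$. Define the strictly concave index function $$\varphi(t):=d_{\xi^\dagger}(\Psi^{-1}(t)),\qquad t>0,$$ where $$d_{\xi^\dagger}(R):=\min\{\|\xi^\dagger-A^*w\|_{\ell^2}:\ w\in Y^*,\ \|w\|_{Y^*}\le R\},\qquad \Psi(R):=\frac{d_{\xi^\dagger}(R)}{R},\qquad R>0.$$ Let $1<q<\infty$ and, for data $y^\delta\in Y$ with $\|y-y^\delta\|\le\delta$ and $\alpha>0$, let $x_\alpha^\delta$ denote a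 minimizer over $x\in\ell^2$ of $$\Phi_\alpha^\delta(x)=\frac1q\|Ax-y^\delta\|^q+\alpha\,\Omega(x),\qquad \Omega(x)=\|x\|_{\ell^0}+\mathcal R(x).$$ Then the sublinear convergence rate $$\|x_{\alpha_*}^\delta-x^\dagger\|_{\ell^1}=\mathcal O(\varphi(\delta))\quad\text{as}\quad\delta\to0$$ holds true whenever the regularization parameter $\alpha_*>0$ is chosen either a priori as $\alpha_*=\alpha_*(\delta)=\frac{\delta^q}{\varphi(\delta)}$ or a posteriori as $\alpha_*=\alpha_*(\delta,y^\delta)$ by the sequential discrepancy principle.
   Context: $\ell^0$ is the set of real sequences with finitely many nonzero components. For a sequence $x$, $\|x\|_{\ell^0}=\sum_{i=1}^\infty \operatorname{sgn}(|x_i|)$ is the number of its nonzero components ($+\infty$ if $x\notin\ell^0$). $e^{(i)}$ is the $i$-th standard unit sequence in $\ell^2$. $\|\cdot\|$ is the norm of $Y$, and $Y^*$ is the dual of $Y$. The dual of $\ell^2$ is identified with $\ell^2$, so that $\langle A^*w,x\rangle=\langle w,Ax\rangle_{Y^*\times Y}$. $\mathcal D(\mathcal R)=\{x\in\ell^2:\mathcal R(x)<\infty\}$, and $\partial\mathcal R(x)\subseteq\ell^2$ is the convex subdifferential of $\mathcal R$ at $x$. An index function is a continuous strictly increasing function $\varphi:(0,\infty)\to(0,\infty)$ with $\lim_{t\to+0}\varphi(t)=0$. In the situation considered, the distance function $d_{\xi^\dagger}$ is positive and strictly decreasing with $\lim_{R\to\infty}d_{\xi^\dagger}(R)=0$.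 Sequential discrepancy principle: for sufficiently large $\alpha_0>0$ and prescribed constants $0<\nu<1$, $\tau>1$, let $\alpha_j=\nu^j\alpha_0$ and $\Delta_\nu=\{\alpha_j: j=1,2,\dots\}$. The parameter $\alpha_*=\alpha_{j_*}\in\Delta_\nu$ is chosen according to the principle if $$\|Ax_{\alpha_{j_*}}^\delta-y^\delta\|\le\tau\delta<\|Ax_{\alpha_{j_*-1}}^\delta-y^\delta\|.$$
   Formalization: The strict concavity of the index function φ is not claimed, since it fails in general (φ can be nearly constant on an interval near 0 and then increase); φ is proved to be an index function with t/φ(t) → 0, and both rates are proved without concavity. *)

(* Defs.v *)
From HB Require Import structures.
From mathcomp Require Import all_boot all_order all_algebra.
From mathcomp Require Import all_classical all_reals all_analysis.
From mathcomp Require Import ring lra.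
Import Order.TTheory GRing.Theory Num.Theory.
Import numFieldNormedType.Exports.

Set Implicit Arguments.
Unset Strict Implicit.
Unset Printing Implicit Defensive.

Local Open Scope classical_set_scope.
Local Open Scope ring_scope.

(* Sequences are indexed from 0 instead of 1. *)

Section SquareSummable.
Context {R : realType}.
Implicit Types (x y : nat -> R) (a : R).

Definition square_summable : {pred nat -> R} :=
  [pred x : nat -> R | `[< cvgn (series (fun i => x i ^+ 2)) >]].

Lemma square_summableP x :
  reflect (cvgn (series (fun i => x i ^+ 2))) (x \in square_summable).
Proof. exact: asboolP. Qed.

Let sqD x y i : (x i + y i) ^+ 2 <= 2 * x i ^+ 2 + 2 * y i ^+ 2.
Proof.
rewrite -subr_ge0 (_ : _ - _ = (x i - y i) ^+ 2) ?sqr_ge0//.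
by rewrite sqrrD sqrrB !mulr2n !mulrDl !mul1r; lra.
Qed.

Lemma square_summable_submod : submod_closed square_summable.
Proof.
split=> [|a x y /square_summableP x2 /square_summableP y2].
  apply/square_summableP; rewrite (_ : series _ = cst 0); first exact: is_cvg_cst.
  by apply/funext => n; rewrite /series/= big1// => i _; rewrite expr0n.
apply/square_summableP.
apply: (@series_le_cvg _ _ (fun i => 2 * a ^+ 2 * x i ^+ 2 + 2 * y i ^+ 2)).
- by move=> i; rewrite sqr_ge0.
- by move=> i; rewrite addr_ge0// mulr_ge0 ?sqr_ge0// mulr_ge0 ?sqr_ge0.
- by move=> i; rewrite (le_trans (sqD (a *: x) y i))//= exprMn mulrA.
- rewrite (_ : (fun i => _) = (2 * a ^+ 2) *: (fun i => x i ^+ 2) +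
      (2 : R) *: (fun i => y i ^+ 2)); last by apply/funext.
  by apply: is_cvg_seriesD; apply: is_cvg_seriesZ.
Qed.

HB.instance Definition _ :=
  GRing.isSubmodClosed.Build R (nat -> R) square_summable square_summable_submod.

End SquareSummable.

Record l2 (R : realType) := L2 {
  l2_seq :> nat -> R;
  l2_seqP : l2_seq \in square_summable }.

HB.instance Definition _ (R : realType) := [isSub for @l2_seq R].
HB.instance Definition _ (R : realType) := [Choice of l2 R by <:].
HB.instance Definition _ (R : realType) := [SubChoice_isSubLmodule of l2 R by <:].

Section InnerProduct.
Context {R : realType}.
Implicit Types (x y z : l2 R) (a : R).

Definition inner x y : R := limn (series (fun i => x i * y i)).

Definition l2_norm x : R := Num.sqrt (inner x x).

Lemma l2P x y : x = y <-> forall i, x i = y i.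
Proof. by split=> [->//|xy]; apply/val_inj/funext. Qed.

Lemma inner_cvg x y : cvgn (series (fun i => x i * y i)).
Proof.
have /square_summableP x2 := l2_seqP x; have /square_summableP y2 := l2_seqP y.
apply: normed_cvg; rewrite /normed_series_of/=.
apply: (@series_le_cvg _ (fun i => `|x i * y i|)
  (fun i => x i ^+ 2 + y i ^+ 2)).
- by move=> i; rewrite normr_ge0.
- by move=> i; rewrite addr_ge0 ?sqr_ge0.
- move=> i; rewrite normrM -(real_normK (num_real (x i))).
  rewrite -(real_normK (num_real (y i))).
  have := sqr_ge0 (`|x i| - `|y i|); rewrite sqrrB mulr2n.
  have : 0 <= `|x i| * `|y i| by rewrite mulr_ge0.
  lra.
- rewrite (_ : (fun i => _) = (fun i => x i ^+ 2) + (fun i => y i ^+ 2)) //.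
  exact: is_cvg_seriesD.
Qed.

Lemma innerC x y : inner x y = inner y x.
Proof.
by rewrite /inner; congr (limn (series _)); apply/funext => i; rewrite mulrC.
Qed.

Lemma innerDl x y z : inner (x + y) z = inner x z + inner y z.
Proof.
rewrite /inner -lim_seriesD; [|exact: inner_cvg|exact: inner_cvg].
by congr (limn (series _)); apply/funext => i; rewrite /= mulrDl.
Qed.

Lemma innerZl a x z : inner (a *: x) z = a * inner x z.
Proof.
rewrite /inner -[RHS]/(a *: _) -lim_seriesZ; last exact: inner_cvg.
by congr (limn (series _)); apply/funext => i; rewrite /= -mulrA.
Qed.

Lemma innerDr x y z : inner z (x + y) = inner z x + inner z y.
Proof. by rewrite innerC innerDl !(innerC _ z). Qed.

Lemma innerZr a x z : inner z (a *: x) = a * inner z x.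
Proof. by rewrite innerC innerZl (innerC _ z). Qed.

Lemma inner_coord x i : x i ^+ 2 <= inner x x.
Proof.
have nd : nondecreasing_seq (series (fun i => x i * x i)).
  by apply/nondecreasing_seqP => n; rewrite seriesSr lerDl -expr2 sqr_ge0.
apply: le_trans (nondecreasing_cvgn_le nd (@inner_cvg x x) i.+1).
rewrite /series/= big_nat_recr//= expr2 lerDr.
by rewrite sumr_ge0// => j _; rewrite -expr2 sqr_ge0.
Qed.

Lemma inner_ge0 x : 0 <= inner x x.
Proof. exact: le_trans (sqr_ge0 _) (inner_coord x 0). Qed.

Lemma l2_normK x : l2_norm x ^+ 2 = inner x x.
Proof. by rewrite /l2_norm sqr_sqrtr ?inner_ge0. Qed.

Lemma l2_norm_ge0 x : 0 <= l2_norm x. Proof. exact: sqrtr_ge0. Qed.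

Lemma l2_norm0_eq0 x : l2_norm x = 0 -> x = 0.
Proof.
move=> x0; apply/l2P => i; apply/eqP; rewrite -sqrf_eq0 eq_le sqr_ge0 andbT.
by rewrite (le_trans (inner_coord x i))// -l2_normK x0 expr0n.
Qed.

Lemma l2_normZ a x : l2_norm (a *: x) = `|a| * l2_norm x.
Proof.
rewrite /l2_norm innerZl innerZr mulrA -expr2 sqrtrM ?sqr_ge0//.
by rewrite sqrtr_sqr.
Qed.

Lemma cauchy_schwarz x y : inner x y <= l2_norm x * l2_norm y.
Proof.
have [y0|y0] := eqVneq (l2_norm y) 0.
  have -> : y = 0 by exact: l2_norm0_eq0.
  rewrite -(scale0r (0 : l2 R)) innerZr mul0r.
  by rewrite mulr_ge0 ?l2_norm_ge0.
have [x0|x0] := eqVneq (l2_norm x) 0.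
  have -> : x = 0 by exact: l2_norm0_eq0.
  rewrite -(scale0r (0 : l2 R)) innerZl mul0r.
  by rewrite mulr_ge0 ?l2_norm_ge0.
set u := l2_norm x in x0 *; set v := l2_norm y in y0 *.
have u0 : 0 < u by rewrite lt_neqAle eq_sym x0 l2_norm_ge0.
have v0 : 0 < v by rewrite lt_neqAle eq_sym y0 l2_norm_ge0.
have := inner_ge0 (v *: x + (- u) *: y).
rewrite !(innerDl, innerDr, innerZl, innerZr) -!l2_normK -/u -/v (innerC y x).
rewrite (_ : _ + _ = (2 * (u * v)) * (u * v - inner x y)); last by ring.
by rewrite pmulr_rge0 ?mulr_gt0// subr_ge0.
Qed.

Lemma l2_normD x y : l2_norm (x + y) <= l2_norm x + l2_norm y.
Proof.
rewrite -(ler_pXn2r (n := 2)) ?nnegrE ?addr_ge0 ?l2_norm_ge0//.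
rewrite l2_normK !(innerDl, innerDr) sqrrD -!l2_normK (innerC y x) mulr2n.
have := cauchy_schwarz x y; lra.
Qed.

HB.instance Definition _ :=
  Lmodule_isNormed.Build R (l2 R) l2_normD l2_normZ l2_norm0_eq0.

Lemma unit_seq_summable (k : nat) :
  (fun i => (i == k)%:R : R) \in square_summable.
Proof.
apply/square_summableP; apply: (is_cvg_near_cst (1 : R)).
near=> n; rewrite /series/= (bigD1_seq k) ?iota_uniq//=; last first.
  by rewrite mem_index_iota; near: n; exists k.+1.
by rewrite eqxx expr1n big1 ?addr0// => i /negPf->; rewrite expr0n.
Unshelve. all: by end_near. Qed.

Definition unit_seq (k : nat) : l2 R := L2 (unit_seq_summable k).

Definition weak_cvg (u : nat -> l2 R) (x : l2 R) : Prop :=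
  forall z, inner z (u n) @[n --> \oo] --> inner z x.

Definition weakly_seq_precompact (S : set (l2 R)) : Prop :=
  forall u : nat -> l2 R, (forall n, S (u n)) ->
    exists2 k : nat -> nat, {homo k : m n / (m < n)%N} &
      exists x, weak_cvg (u \o k) x.

End InnerProduct.

Section SequenceNorms.
Context {R : realType}.
Implicit Type x : nat -> R.
Local Open Scope ereal_scope.

Definition seq_support x : set nat := [set i | x i != 0%R].

Definition in_l0 x : Prop := finite_set (seq_support x).

Definition l0_norm x : \bar R := \sum_(i <oo) (Num.sg `|x i|)%:E.

Definition l1_norm x : \bar R := \sum_(i <oo) `|x i|%:E.

End SequenceNorms.

Section Functionals.
Context {R : realType}.
Implicit Types (F : l2 R -> \bar R) (x xi : l2 R).
Local Open Scope ereal_scope.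

Definition effective_domain F : set (l2 R) := [set x | F x < +oo].

Definition proper_functional F : Prop := effective_domain F !=set0.

(* With values in [0, +oo] the right-hand side is never of the form oo - oo,
   and 0 * +oo = 0. *)
Definition convex_functional F : Prop :=
  forall (t : R) x y, (0 <= t <= 1)%R ->
    F (t *: x + (1 - t) *: y)%R <= t%:E * F x + (1 - t)%:E * F y.

Definition stabilizing F : Prop :=
  forall c : R, (0 <= c)%R -> weakly_seq_precompact [set x | F x <= c%:E].

Definition subdifferential F x : set (l2 R) :=
  [set xi | effective_domain F x /\
            forall z, F x + (inner xi (z - x)%R)%:E <= F z].

Definition is_minimizer F x : Prop := forall z, F x <= F z.

End Functionals.

Record dual_space (R : realType) (Y : normedModType R) := Dual {
  dual_fun :> {linear Y -> R^o};
  dual_continuous : continuous dual_fun }.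

Section Operators.
Context {R : realType} {Y : normedModType R}.
Implicit Types (A : {linear l2 R -> Y}) (w : dual_space Y).

Definition dual_norm w : R := sup [set `|w y| | y in [set y : Y | `|y| <= 1]].

Definition infinite_dimensional : Prop :=
  forall (n : nat) (v : 'I_n -> Y),
    exists y : Y, forall c : 'I_n -> R, y <> \sum_i c i *: v i.

Definition bounded_operator A : Prop :=
  exists M : R, forall x, `|A x| <= M * `|x|.

(* The dual of l^2 being identified with l^2 through [inner], this determines
   [Astar] uniquely. *)
Definition is_adjoint A (Astar : dual_space Y -> l2 R) : Prop :=
  forall w x, inner (Astar w) x = w (A x).

End Operators.
Arguments infinite_dimensional {R} Y.

Section RateFunction.
Context {R : realType} {Y : normedModType R}.
Variables (Astar : dual_space Y -> l2 R) (xi : l2 R).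

(* The infimum is a minimum by weak-* compactness of the balls of the dual. *)
Definition distance_function (r : R) : R :=
  inf [set `|xi - Astar w| | w in [set w | dual_norm w <= r]].

Definition Psi (r : R) : R := distance_function r / r.

Definition rate_function (t : R) : R :=
  distance_function ('pinv_(fun=> 0) `]0, +oo[ Psi t).

End RateFunction.

Definition index_function {R : realType} (f : R -> R) : Prop :=
  [/\ forall t, 0 < t -> 0 < f t,
      {in `]0, +oo[, continuous f},
      forall s t, 0 < s -> s < t -> f s < f t
    & f t @[t --> 0^'+] --> 0].

Definition sublinear_rate {R : realType} (f : R -> R) : Prop :=
  t / f t @[t --> 0^'+] --> 0.

Section Tikhonov.
Context {R : realType} {Y : normedModType R}.
Variables (A : {linear l2 R -> Y}) (Reg : l2 R -> \bar R) (q : R).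
Implicit Types (yd : Y) (delta alpha : R) (xs : R -> l2 R).

Definition Omega (x : l2 R) : \bar R := (l0_norm x + Reg x)%E.

Definition tikhonov yd alpha (x : l2 R) : \bar R :=
  ((q^-1 * `|A x - yd| `^ q)%:E + alpha%:E * Omega x)%E.

(* [xs] is a selection: minimizers need not be unique. *)
Definition regularized yd xs : Prop :=
  forall alpha, 0 < alpha -> is_minimizer (tikhonov yd alpha) (xs alpha).

(* A parameter choice [choice delta yd xs alpha] states that [alpha] is selected
   for the noise level [delta], the data [yd] and the minimizers [xs]. *)
Definition a_priori_choice (phi : R -> R) delta yd xs alpha : Prop :=
  alpha = delta `^ q / phi delta.

Definition discrepancy_principle (alpha0 nu tau : R) delta yd xs alpha : Prop :=
  let a j := nu ^+ j * alpha0 in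
  exists j : nat, [/\ (0 < j)%N, alpha = a j,
    `|A (xs (a j)) - yd| <= tau * delta
  & tau * delta < `|A (xs (a j.-1)) - yd|].

(* O(phi(delta)) as delta -> 0+, with a constant that depends neither on the
   noisy data nor on the selection of the minimizers. *)
Definition l1_convergence_rate (y : Y) (xdag : l2 R)
    (choice : R -> Y -> (R -> l2 R) -> R -> Prop) (phi : R -> R) : Prop :=
  exists C : R, \forall delta \near 0^'+,
    forall yd xs alpha, `|y - yd| <= delta -> regularized yd xs ->
      choice delta yd xs alpha ->
      (l1_norm (xs alpha - xdag)%R <= (C * phi delta)%:E)%E.

End Tikhonov.

(* Main.v *)
From HB Require Import structures.
Require Import Defs.
From mathcomp Require Import all_boot all_order all_algebra.
From mathcomp Require Import all_classical all_reals all_analysis.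
From mathcomp Require Import ring lra.
Import Order.TTheory GRing.Theory Num.Theory.
Import numFieldNormedType.Exports.

(** The l^1 error splits into a part seen by the operator and a part paid for by
    the l^0 penalty.  On the finite support of [xdag] every coordinate is a
    functional [A* omega_i], so it is controlled by the residual
    [t = |A x - A xdag|]; off the support each nonzero coordinate of a bounded
    [x] costs at most a constant, and the l^0 norm counts exactly these
    coordinates ([sparsity_inequality]).

    The functional [Reg] can only lower the objective by as much as the
    subgradient [xi] allows.  As [xi] is not of the form [A* w], one replaces it
    by the best [A* w] with [|w| <= r], at the price [r t] for the residual and
    [d(r)] for the approximation.  The two prices balance when [d(r) / r = t],
    where both equal [phi t]; this explains the rate function.  With the previous
    paragraph this gives [variational_inequality]:
    [|x - xdag|_1 <= b (Omega x - Omega xdag) + C l phi(delta)] as soon as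
    [t <= l delta], uniformly on sublevel sets of [Omega].  Such sets are weakly
    precompact, hence bounded by the Banach-Steinhaus theorem on the complete
    space l^2.

    It remains to see that both parameter choices make the residual
    [O(delta)] and the gap [Omega x - Omega xdag] at most [O(phi(delta))].  The
    minimizing property gives [s^q + q alpha (gap) <= delta^q], where
    [s = |A x - yd|].
    For the a priori choice the gap is at most [phi(delta)], and a residual
    [l delta] forces [(l - 1)^q <= 1 + D l], which bounds [l] because [q > 1].
    For the discrepancy principle the residual is [O(delta)] by definition, and
    the gap is bounded through [delta^q <= C alpha phi(delta)], obtained from
    the rejected parameter [alpha / nu], whose residual is too large.

    The properties of [phi] come from those of the distance function [d]: it is
    positive because [xi] is outside the range of [A*] and the images of balls
    under [A*] are closed ([adjoint_ball_closed]), it is convex, and it tends to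
    [0] because the unit sequences, whose span is dense, lie in that range.
    Then [phi t = t r(t)] with [r(t)] decreasing, so that
    [phi s <= phi t <= (t / s) phi s] for [s <= t], which makes [phi] continuous;
    it is sublinear because [r(t)] tends to infinity as [t] tends to [0]. *)

Local Open Scope classical_set_scope.
Local Open Scope ring_scope.

Set Implicit Arguments.
Unset Strict Implicit.
Unset Printing Implicit Defensive.

(** * Functionals on a normed space *)

Section Dual.
Context {R : realType} {Y : normedModType R}.
Implicit Types (w : dual_space Y) (f : Y -> R).

Let dual_bound_ex w : exists2 M : R, 0 <= M & forall y, `|w y| <= M * `|y|.
Proof.
have /linear_bounded_continuous/linear_boundedP H := @dual_continuous R Y w.
have [M M0 HM] := pinfty_ex_gt0 H.
by exists M => //; exact: ltW.
Qed.

Let dual_has_ubound w :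
  has_ubound [set `|w y| | y in [set y : Y | `|y| <= 1]].
Proof.
have [M M0 HM] := dual_bound_ex w.
exists M => _ [y /= y1 <-]; apply: le_trans (HM y) _.
by rewrite -[leRHS]mulr1 ler_wpM2l.
Qed.

Lemma dual_norm_ge0 w : 0 <= dual_norm w.
Proof.
apply: le_trans (normr_ge0 (w 0)) _.
by apply: ub_le_sup; [exact: dual_has_ubound|exists 0 => //=; rewrite normr0].
Qed.

Lemma dual_normP w y : `|w y| <= dual_norm w * `|y|.
Proof.
have [->|y0] := eqVneq y 0; first by rewrite linear0 !normr0 mulr0.
have ny0 : 0 < `|y| by rewrite normr_gt0.
rewrite -ler_pdivrMr// -(normr_id y) -normrV ?unitfE ?gt_eqF// -normrM mulrC.
rewrite -[_ * w y]/(_ *: w y) -linearZ.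
apply: ub_le_sup; first exact: dual_has_ubound.
exists (`|y|^-1 *: y) => //=.
by rewrite normrZ normfV normr_id mulVf ?gt_eqF.
Qed.

Lemma dual_norm_le w (M : R) :
  (forall y, `|w y| <= M * `|y|) -> 0 <= M -> dual_norm w <= M.
Proof.
move=> HM M0; apply: ge_sup.
  by exists `|w 0|, 0 => //=; rewrite normr0.
move=> _ [y /= y1 <-]; apply: le_trans (HM y) _.
by rewrite -[leRHS]mulr1 ler_wpM2l.
Qed.

Lemma bounded_functional_dual f (M : R) :
  (forall a x y, f (a *: x + y) = a * f x + f y) ->
  (forall y, `|f y| <= M * `|y|) ->
  exists w : dual_space Y, forall y, w y = f y.
Proof.
move=> lf bf.
have lf' : linear (f : Y -> R^o) by [].
pose g : {linear Y -> R^o} :=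
  HB.pack (f : Y -> R^o) (GRing.isLinear.Build R Y R^o *:%R _ lf').
have cg : continuous g.
  apply/linear_bounded_continuous/linear_boundedP.
  exists M; split=> [|r Mr x]; first exact: num_real.
  by apply: le_trans (bf x) _; rewrite ler_wpM2r// ltW.
by exists (Dual cg).
Qed.

(** The dual space is only a type of functionals, without a module structure;
    linear combinations are therefore obtained through their existence. *)
Lemma dual_comb (a b : R) w1 w2 :
  exists2 w : dual_space Y, (forall y, w y = a * w1 y + b * w2 y) &
    dual_norm w <= `|a| * dual_norm w1 + `|b| * dual_norm w2.
Proof.
pose M := `|a| * dual_norm w1 + `|b| * dual_norm w2.
have bf y : `|a * w1 y + b * w2 y| <= M * `|y|.
  apply: le_trans (ler_normD _ _) _; rewrite !normrM mulrDl -!mulrA.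
  by apply: lerD; rewrite ler_wpM2l// dual_normP.
have [|w Hw] := @bounded_functional_dual (fun y => a * w1 y + b * w2 y) M _ bf.
  move=> c x y; rewrite !linearP /= -![_ *: _]/(_ * _); ring.
exists w => //; apply: dual_norm_le => [y|]; first by rewrite Hw.
by rewrite addr_ge0// mulr_ge0// dual_norm_ge0.
Qed.

End Dual.

(** * Completeness of l^2 and boundedness of weakly precompact sets *)

Section SquareSummableSequences.
Context {R : realType}.
Implicit Types (x y z : l2 R).

Lemma l2_addE x y i : (x + y) i = x i + y i. Proof. by []. Qed.
Lemma l2_oppE x i : (- x) i = - x i. Proof. by []. Qed.
Lemma l2_scaleE (a : R) x i : (a *: x) i = a * x i. Proof. by []. Qed.

Lemma l2_sumE I (r : seq I) (P : pred I) (F : I -> l2 R) i :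
  (\sum_(j <- r | P j) F j) i = \sum_(j <- r | P j) F j i.
Proof.
by elim/big_rec2: _ => [//|j u v _ <-]; rewrite l2_addE.
Qed.

Lemma l2_sqr_norm x : `|x| ^+ 2 = inner x x.
Proof. exact: l2_normK. Qed.

Lemma l2_coord_le x i : `|x i| <= `|x|.
Proof.
rewrite -(ler_pXn2r (n := 2)) ?nnegrE// l2_sqr_norm real_normK ?num_real//.
exact: inner_coord.
Qed.

Lemma inner_norm_le x y : `|inner x y| <= `|x| * `|y|.
Proof.
rewrite ler_norml; apply/andP; split; last exact: cauchy_schwarz.
rewrite lerNl -mulN1r -innerZl scaleN1r -(normrN x).
exact: cauchy_schwarz.
Qed.

Lemma inner_unit_seq x i : inner x (unit_seq i) = x i.
Proof.
apply/cvg_lim => //; apply: cvg_near_cst; near=> n.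
rewrite /series/= (bigD1_seq i) ?iota_uniq//=; last first.
  by rewrite mem_index_iota; near: n; exists i.+1.
by rewrite eqxx mulr1 big1 ?addr0// => j /negPf->; rewrite mulr0.
Unshelve. all: by end_near. Qed.

Lemma inner_inj x y : (forall z, inner x z = inner y z) -> x = y.
Proof. by move=> xy; apply/l2P => i; rewrite -!inner_unit_seq. Qed.

(** Coordinatewise limits are recognized as elements of l^2, with a norm bound,
    from their partial sums of squares alone. *)
Lemma l2_of_bounded_sums (z : nat -> R) (M : R) : 0 <= M ->
  (forall n, \sum_(0 <= i < n) z i ^+ 2 <= M ^+ 2) ->
  exists2 x : l2 R, (forall i, x i = z i) & `|x| <= M.
Proof.
move=> M0 HM.
have nd : nondecreasing_seq (series (fun i => z i ^+ 2)).
  by apply/nondecreasing_seqP => n; rewrite seriesSr lerDl sqr_ge0.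
have cz : cvgn (series (fun i => z i ^+ 2)).
  by apply: nondecreasing_is_cvgn => //; exists (M ^+ 2) => _ [n _ <-]; exact: HM.
have zP : z \in square_summable by exact/square_summableP.
exists (L2 zP) => //.
rewrite -(ler_pXn2r (n := 2)) ?nnegrE// l2_sqr_norm /inner.
by apply: limr_le => //; apply: nearW => n; exact: HM.
Qed.

Definition truncate x n : l2 R := \sum_(0 <= i < n) x i *: unit_seq i.

Lemma truncateE x n i : truncate x n i = if (i < n)%N then x i else 0.
Proof.
rewrite /truncate l2_sumE.
transitivity (\sum_(0 <= j < n) if j == i then x i else 0).
  apply: eq_bigr => j _; rewrite l2_scaleE/= eq_sym.
  by case: eqVneq => [->|]; rewrite ?mulr1 ?mulr0.
rewrite -big_mkcond big_nat_cond/=.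
case: ltnP => ni; last first.
  by rewrite big1// => j /andP[jn /eqP ji]; move: jn; rewrite ji ltnNge ni.
rewrite -big_nat_cond -big_filter filter_pred1_uniq ?iota_uniq ?big_seq1//.
by rewrite mem_index_iota.
Qed.

Lemma inner_truncate x z n :
  inner z (truncate x n) = \sum_(0 <= i < n) x i * z i.
Proof.
rewrite /truncate; elim/big_rec2: _ => [|i u v _ <-].
  by rewrite -(scale0r (0 : l2 R)) innerZr mul0r.
by rewrite innerDr innerZr inner_unit_seq.
Qed.

Lemma truncate_dense x (e : R) : 0 < e -> exists n, `|x - truncate x n| < e.
Proof.
move=> e0.
have dist n : `|x - truncate x n| ^+ 2 = inner x x - series (fun i => x i * x i) n.
  have eqS y : (forall i, (i < n)%N -> y i = x i) ->
      inner y (truncate x n) = series (fun i => x i * x i) n.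
    move=> yx; rewrite inner_truncate /series/= !big_nat.
    by apply: eq_bigr => i /andP[_ /yx ->].
  rewrite l2_sqr_norm -scaleN1r !(innerDl, innerDr, innerZl, innerZr).
  rewrite (innerC (truncate x n) x) !eqS//; first ring.
  by move=> i ni; rewrite truncateE ni.
have := @cvgr_dist_lt _ _ _ _ _ _ _ (@inner_cvg _ x x) (e ^+ 2) (exprn_gt0 _ e0).
move=> [n _ /(_ n (leqnn n)) /= xn]; exists n.
rewrite -(ltr_pXn2r (n := 2)) ?nnegrE ?(ltW e0)// dist.
exact: le_lt_trans (ler_norm _) xn.
Qed.

Lemma l2_partial_sum_le x n : \sum_(0 <= i < n) x i ^+ 2 <= `|x| ^+ 2.
Proof.
have nd : nondecreasing_seq (series (fun i => x i * x i)).
  by apply/nondecreasing_seqP => k; rewrite seriesSr lerDl -expr2 sqr_ge0.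
rewrite l2_sqr_norm; apply: le_trans (nondecreasing_cvgn_le nd (@inner_cvg _ x x) n).
by rewrite /series/=; apply: ler_sum => i _; rewrite expr2.
Qed.

(** A Cauchy filter converges in each coordinate.  If most of it lies in the ball
    of radius [e] around [x], passing to the limit in the partial sums shows that
    [x] minus the coordinatewise limit has norm at most [e]. *)
Lemma l2_complete (F : set_system (l2 R)) : ProperFilter F -> cauchy F -> cvg F.
Proof.
move=> FF /cauchyP Fc; apply/cvg_ex.
have Fcoord i : exists a : R, x i @[x --> F] --> a.
  apply/cvg_ex; apply: (@cauchy_cvg R (x i @[x --> F])).
  apply: (@cauchy_exP R R (x i @[x --> F])) => e e0; have [x Fx] := Fc e e0; exists (x i).
  apply: (@filterS _ F _ (ball x e)) => // y; rewrite -!ball_normE/= => xy.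
  exact: le_lt_trans (l2_coord_le (x - y) i) xy.
have [z Fz] := choice Fcoord.
have near_limit x e : 0 < e -> F (ball x e) ->
    exists2 u : l2 R, (forall i, u i = x i - z i) & `|u| <= e.
  move=> e0 Fx; apply: l2_of_bounded_sums => [|n]; first exact: ltW.
  apply: (@cvgr_to_le _ F _ _ (fun y : l2 R => \sum_(0 <= i < n) (x i - y i) ^+ 2)).
    elim: n => [|n IH].
      under eq_fun do rewrite big_nil; rewrite big_nil; exact: cvg_cst.
    under eq_fun do rewrite big_nat_recr//=.
    rewrite big_nat_recr//=; apply: cvgD => //.
    have cxz : x n - y n @[y --> F] --> x n - z n.
      by apply: cvgB; [exact: cvg_cst|exact: Fz].
    under eq_fun do rewrite expr2.
    by rewrite expr2; exact: cvgM.
  apply: filterS Fx => y; rewrite -ball_normE/= => xy.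
  apply: le_trans (l2_partial_sum_le (x - y) n) _.
  by rewrite ler_pXn2r ?nnegrE ?(ltW e0)// ltW.
have [x1 Fx1] := Fc 1 ltr01.
have [u1 u1E _] := near_limit x1 1 ltr01 Fx1.
exists (x1 - u1); apply/cvgrPdist_lt => e e0.
have e20 : 0 < e / 2 by rewrite divr_gt0.
have [x Fx] := Fc _ e20; have [u uE ue] := near_limit x _ e20 Fx.
have -> : x1 - u1 = x - u.
  by apply/l2P => i; rewrite !l2_addE !l2_oppE u1E uE; ring.
apply: filterS Fx => y; rewrite -ball_normE/= => xy.
rewrite (_ : x - u - y = (x - y) - u); last by rewrite addrAC.
apply: le_lt_trans (ler_normB _ _) _.
by rewrite [ltRHS]splitr; apply: ltr_leD.
Qed.

End SquareSummableSequences.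

HB.instance Definition _ (R : realType) :=
  Uniform_isComplete.Build (l2 R) (@l2_complete R).

Section WeakCompactness.
Context {R : realType}.

(** Uniform boundedness applied to the functionals [inner (u n)], which converge
    pointwise. *)
Lemma weak_cvg_bounded (u : nat -> l2 R) (x : l2 R) :
  weak_cvg u x -> exists M, forall n, `|u n| <= M.
Proof.
move=> ux.
pose F := [set f | exists n, f = (inner (u n) : l2 R -> R^o)].
have linF f : F f -> bounded_fun_norm f /\ linear f.
  move=> [n ->]; split=> [r|a y z]; last by rewrite innerDr innerZr.
  exists (`|u n| * r) => y yr; apply: le_trans (inner_norm_le _ _) _.
  by rewrite ler_wpM2l.
have ptF : pointwise_bounded F.
  move=> z; have /cvg_seq_bounded[M [_ HM]] : cvgn (fun n => inner z (u n)).
    by apply/cvg_ex; exists (inner z x); exact: ux.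
  exists (M + 1) => _ [n ->]; rewrite innerC.
  by apply: (HM (M + 1)) => //; rewrite ltrDl.
have [M HM] := @Banach_Steinhauss R (l2 R) R^o F linF ptF 1.
exists M => n; have [->|un0] := eqVneq (u n) 0.
  rewrite normr0; apply: le_trans (normr_ge0 _) (HM (inner (u n)) _ 0 _).
    by exists n.
  by rewrite normr0.
have nun : 0 < `|u n| by rewrite normr_gt0.
have -> : `|u n| = `|inner (u n) (`|u n|^-1 *: u n)|.
  by rewrite innerZr -l2_sqr_norm expr2 mulKf ?gt_eqF// normr_id.
apply: HM; first by exists n.
by rewrite normrZ normfV normr_id mulVf ?gt_eqF.
Qed.

Lemma weakly_seq_precompact_bounded (S : set (l2 R)) :
  weakly_seq_precompact S -> exists M, forall x, S x -> `|x| <= M.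
Proof.
move=> Sc; apply: contrapT => unb.
have big n : exists x, S x /\ n%:R < `|x|.
  apply: contrapT => nex; apply: unb; exists n%:R => x Sx.
  by rewrite leNgt; apply/negP => nx; apply: nex; exists x.
have [u uP] := choice big.
have [k kmono [x kx]] := Sc u (fun n => (uP n).1).
have [M HM] := weak_cvg_bounded kx.
have kge n : (n <= k n)%N.
  elim: n => // n IH; exact: leq_ltn_trans IH (kmono _ _ (ltnSn n)).
have := (uP (k (Num.trunc M).+1)).2; apply/negP; rewrite -leNgt.
apply: le_trans (HM (Num.trunc M).+1) _.
apply: le_trans (ltW (truncnS_gt M)) _.
by rewrite ler_nat kge.
Qed.

End WeakCompactness.

(** * The distance function *)

Lemma ultra_fmap (T U : Type) (f : T -> U) (F : set_system T) :
  UltraFilter F -> UltraFilter (f @ F).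
Proof.
move=> FU; split=> [|G GF fG]; first exact: fmap_proper_filter.
apply/seteqP; split=> // B GB.
have [//|FnB] := in_ultra_setVsetC (f @^-1` B) FU.
have /filter_ex[x [] //] : G (B `&` ~` B) by apply: filterI GB _; exact: fG.
Qed.

Section AdjointRange.
Context {R : realType} {Y : normedModType R}.
Variables (A : {linear l2 R -> Y}) (Astar : dual_space Y -> l2 R).
Hypothesis adj : is_adjoint A Astar.
Implicit Types (w : dual_space Y) (xi : l2 R) (r : R).

Let adjointE w u : (forall x, w (A x) = inner u x) -> Astar w = u.
Proof. by move=> wu; apply: inner_inj => z; rewrite adj wu. Qed.

Lemma adjoint_comb (a b : R) w1 w2 : exists2 w,
  Astar w = a *: Astar w1 + b *: Astar w2 &
  dual_norm w <= `|a| * dual_norm w1 + `|b| * dual_norm w2.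
Proof.
have [w wE wn] := dual_comb a b w1 w2; exists w => //.
by apply: adjointE => x; rewrite wE innerDl !innerZl !adj.
Qed.

Lemma adjoint0 : exists2 w, Astar w = 0 & dual_norm w <= 0.
Proof.
have [||w wE] := @bounded_functional_dual R Y (fun=> 0) 0.
- by move=> a x y; rewrite mulr0 addr0.
- by move=> y; rewrite normr0 mul0r.
exists w; last by apply: dual_norm_le => // y; rewrite wE normr0 mul0r.
by apply: adjointE => x; rewrite wE -(scale0r (0 : l2 R)) innerZl mul0r.
Qed.

(** Weak-* compactness, in the form needed here: a sequence of functionals in the
    ball converges pointwise along an ultrafilter, the limit is linear and obeys
    the same bound, and its image under the adjoint is the limit [xi] of the
    images. *)
Lemma adjoint_ball_closed xi r :
  (forall e, 0 < e -> exists2 w, dual_norm w <= r & `|xi - Astar w| < e) ->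
  exists w, xi = Astar w.
Proof.
move=> H.
have /choice[v vP] n : exists w, dual_norm w <= r /\
    `|xi - Astar w| < n.+1%:R^-1.
  by have [|w] := H n.+1%:R^-1; [rewrite invr_gt0|exists w].
have [U [UU UF]] := @ultraFilterLemma _ (\oo : set_system nat) _.
have vb n y : `|v n y| <= r * `|y|.
  by apply: le_trans (dual_normP _ _) _; rewrite ler_wpM2r// (vP n).1.
have /choice[f fP] y : exists a : R, v n y @[n --> U] --> a.
  have := @segment_compact R (- (r * `|y|)) (r * `|y|).
  rewrite compact_ultra => /(_ _ (ultra_fmap (fun n => v n y) UU)).
  case=> [|a [_ va]]; last by exists a.
  by apply: (@filterE _ U) => n /=; rewrite in_itv/= -ler_norml vb.
have lf a x y : f (a *: x + y) = a * f x + f y.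
  transitivity (lim (v n (a *: x + y) @[n --> U])).
    by apply/esym/cvg_lim => //; exact: fP.
  apply/cvg_lim => //.
  under eq_fun do rewrite linearP /=.
  by apply: cvgD => //; apply: cvgM => //; exact: cvg_cst.
have bf y : `|f y| <= r * `|y|.
  rewrite ler_norml; apply/andP; split.
    apply: (cvgr_to_ge (fP y)); apply: filterE => n.
    by have := vb n y; rewrite ler_norml => /andP[].
  apply: (cvgr_to_le (fP y)); apply: filterE => n.
  by have := vb n y; rewrite ler_norml => /andP[].
have [w wE] := bounded_functional_dual lf bf; exists w; apply/esym.
apply: adjointE => x; rewrite wE.
transitivity (lim (v n (A x) @[n --> U])).
  by apply/esym/cvg_lim => //; exact: fP.
apply/cvg_lim => //.
suff vx : v n (A x) @[n --> \oo] --> inner xi x by exact: cvg_trans (cvg_app _ UF) vx.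
apply/cvgrPdist_lt => e e0.
have xe : 0 < e / (`|x| + 1) by rewrite divr_gt0// ltr_wpDl.
near=> n.
rewrite -adj -[inner xi x - _]/(inner xi x + - _) -mulN1r -innerZl -innerDl scaleN1r.
apply: le_lt_trans (inner_norm_le _ _) _.
apply: (@le_lt_trans _ _ (n.+1%:R^-1 * (`|x| + 1))).
  by rewrite ler_pM// ?lerDl// ltW// (vP n).2.
rewrite -ltr_pdivlMr ?ltr_wpDl//.
near: n; exact: near_infty_natSinv_lt (PosNum xe).
Unshelve. all: by end_near. Qed.

Section Distance.
Variable xi : l2 R.
Let d := distance_function Astar xi.

Lemma distance_le w r : dual_norm w <= r -> d r <= `|xi - Astar w|.
Proof.
move=> wr; apply: ge_inf; last by exists w.
by exists 0 => _ [v _ <-].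
Qed.

Lemma distance_adherent r e : 0 <= r -> 0 < e ->
  exists2 w, dual_norm w <= r & `|xi - Astar w| < d r + e.
Proof.
move=> r0 e0.
have [|_ [w wr <-] we] := @inf_adherent R
    [set `|xi - Astar w| | w in [set w | dual_norm w <= r]] e e0.
  split; last by exists 0 => _ [v _ <-].
  by have [w _ wn] := adjoint0; exists `|xi - Astar w|, w => //=; exact: le_trans wn r0.
by exists w.
Qed.

Lemma distance_ge0 r : 0 <= r -> 0 <= d r.
Proof.
move=> r0; apply/ler_addgt0Pr => e e0; have [w _] := distance_adherent r0 e0.
by move/ltW; exact: le_trans.
Qed.

Lemma distance_nonincreasing r s : 0 <= r -> r <= s -> d s <= d r.
Proof.
move=> r0 rs; apply/ler_addgt0Pr => e e0.
have [w wr /ltW] := distance_adherent r0 e0; apply: le_trans.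
by apply: distance_le; exact: le_trans rs.
Qed.

Lemma distance_convex (t r s : R) : 0 <= t <= 1 -> 0 <= r -> 0 <= s ->
  d (t * r + (1 - t) * s) <= t * d r + (1 - t) * d s.
Proof.
move=> /andP[t0 t1] r0 s0; apply/ler_addgt0Pr => e e0.
have u0 : 0 <= 1 - t by rewrite subr_ge0.
have [w1 w1r w1e] := distance_adherent r0 e0.
have [w2 w2s w2e] := distance_adherent s0 e0.
have [w wE wn] := adjoint_comb t (1 - t) w1 w2.
rewrite !ger0_norm// in wn.
apply: (@le_trans _ _ `|xi - Astar w|).
  by apply/distance_le/(le_trans wn); apply: lerD; rewrite ler_wpM2l.
rewrite wE (_ : xi - _ = t *: (xi - Astar w1) + (1 - t) *: (xi - Astar w2)).
  apply: le_trans (ler_normD _ _) _; rewrite !normrZ !ger0_norm//.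
  have : t * `|xi - Astar w1| <= t * (d r + e) by rewrite ler_wpM2l// ltW.
  have : (1 - t) * `|xi - Astar w2| <= (1 - t) * (d s + e) by rewrite ler_wpM2l// ltW.
  lra.
by apply/l2P => i; rewrite !(l2_addE, l2_oppE, l2_scaleE); ring.
Qed.

Lemma distance_gt0 r : 0 <= r -> (~ exists w, xi = Astar w) -> 0 < d r.
Proof.
move=> r0 nsrc; rewrite lt_neqAle distance_ge0// andbT; apply/eqP => d0.
apply: nsrc; apply: (@adjoint_ball_closed _ r) => e e0.
by have [w wr] := distance_adherent r0 e0; rewrite -d0 add0r; exists w.
Qed.

(** Every truncation of [xi] is a finite combination of unit sequences, hence
    the image of some functional; the radius is the norm of that functional. *)
Lemma distance_vanishes (e : R) :
  (forall i, exists w, unit_seq i = Astar w) -> 0 < e ->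
  exists2 r, 0 < r & d r < e.
Proof.
move=> src e0; have [n xn] := truncate_dense xi e0.
have [w wE] : exists w, Astar w = truncate xi n.
  elim: n {xn} => [|n [w wE]].
    by have [w wE _] := adjoint0; exists w; rewrite /truncate big_nil.
  have [v vE] := src n; have [u uE _] := adjoint_comb 1 (xi n) w v.
  by exists u; rewrite /truncate big_nat_recr//= uE wE vE scale1r.
exists (dual_norm w + 1); first by rewrite ltr_wpDl// dual_norm_ge0.
by apply: le_lt_trans xn; rewrite -wE; apply: distance_le; rewrite lerDl.
Qed.

End Distance.
End AdjointRange.

(** * The rate function *)

Section RateFunction.
Context {R : realType}.
Variable d : R -> R.
Hypothesis d_gt0 : forall r, 0 <= r -> 0 < d r.
Hypothesis d_nonincreasing : forall r s, 0 <= r -> r <= s -> d s <= d r.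
Hypothesis d_convex : forall t r s, 0 <= t <= 1 -> 0 <= r -> 0 <= s ->
  d (t * r + (1 - t) * s) <= t * d r + (1 - t) * d s.
Hypothesis d_vanishes : forall e, 0 < e -> exists2 r, 0 < r & d r < e.

Let psi (r : R) := d r / r.
Let rinv (t : R) : R := 'pinv_(fun=> 0) `]0, +oo[ psi t.
Let phi (t : R) := d (rinv t).

(** A plateau of a convex nonincreasing function would last forever, which is
    impossible for a positive function tending to [0]. *)
Lemma convex_vanishing_decreasing r s : 0 <= r -> r < s -> d s < d r.
Proof.
move=> r0 rs; have s0 : 0 <= s by exact: le_trans (ltW rs).
have [u u0 du] := d_vanishes (d_gt0 s0).
have su : s < u.
  rewrite ltNge; apply/negP => us.
  by have := d_nonincreasing (ltW u0) us; rewrite leNgt du.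
have ur : 0 < u - r by rewrite subr_gt0 (lt_trans rs).
pose t := (u - s) / (u - r).
have t0 : 0 < t by rewrite divr_gt0 // subr_gt0.
have t1 : t < 1 by rewrite ltr_pdivrMr// mul1r ltrD2l ltrN2.
have := @d_convex t r u; rewrite (ltW t0) (ltW t1) => /(_ isT r0 (ltW u0)).
have -> : t * r + (1 - t) * u = s by rewrite /t; field; rewrite gt_eqF.
move=> dsc; rewrite -(ltr_pM2l t0).
have : (1 - t) * d u < (1 - t) * d s by rewrite ltr_pM2l // subr_gt0.
lra.
Qed.

Let d_lipschitz r s : 0 < r -> 0 <= s -> `|d r - d s| <= `|r - s| / r * d 0.
Proof.
have main a b : 0 <= a -> a < b -> d a - d b <= (b - a) / b * d 0.
  move=> a0 ab; have b0 : 0 < b by exact: le_lt_trans ab.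
  have := @d_convex (a / b) b 0.
  rewrite divr_ge0 ?(ltW b0)//= ler_pdivrMr// mul1r (ltW ab).
  move=> /(_ isT isT (lexx 0)).
  rewrite mulr0 addr0 divfK ?gt_eqF// => dab.
  have -> : (b - a) / b * d 0 = d 0 - a / b * d 0 by field; rewrite gt_eqF.
  have : (1 - a / b) * d b >= 0.
    by rewrite mulr_ge0 ?(ltW (d_gt0 (ltW b0)))// subr_ge0 ler_pdivrMr// mul1r ltW.
  lra.
move=> r0 s0; case: (ltgtP r s) => [rs|sr|->]; last by rewrite !subrr normr0 !mul0r.
- have dd := ltW (convex_vanishing_decreasing (ltW r0) rs).
  rewrite ger0_norm ?subr_ge0// ltr0_norm ?subr_lt0// opprB.
  apply: le_trans (main _ _ (ltW r0) rs) _.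
  rewrite ler_wpM2r ?(ltW (d_gt0 _))// ler_wpM2l ?subr_ge0 ?(ltW rs)//.
  by rewrite lef_pV2 ?posrE ?(lt_trans r0 rs)// ltW.
- have dd := ltW (convex_vanishing_decreasing s0 sr).
  by rewrite distrC ger0_norm ?subr_ge0// gtr0_norm ?subr_gt0// main.
Qed.

Let d_continuous r : 0 < r -> {for r, continuous d}.
Proof.
move=> r0; apply/cvgrPdist_lt => e e0.
have d0 := d_gt0 (lexx 0).
have c0 : 0 < e * r / d 0 by rewrite divr_gt0 ?mulr_gt0.
near=> s; have s0 : 0 < s by near: s; exact: (cvgr_gt r).
apply: le_lt_trans (d_lipschitz r0 (ltW s0)) _.
rewrite -ltr_pdivlMr// ltr_pdivrMr// mulrAC.
by near: s; exact: cvgr_dist_lt.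
Unshelve. all: by end_near. Qed.

Let psi_decreasing r s : 0 < r -> r < s -> psi s < psi r.
Proof.
move=> r0 rs; have s0 : 0 < s by exact: lt_trans rs.
apply: (@le_lt_trans _ _ (d r / s)).
  by rewrite ler_pM2r ?invr_gt0// d_nonincreasing// ltW.
by rewrite ltr_pM2l ?d_gt0 ?(ltW r0)// ltf_pV2 ?posrE.
Qed.

(** Intermediate values of [d r - t r] between a point [a] small enough for
   [t a <= d 1 / 2] and a point [b] with [t b > d 0]. *)
Let psi_surjective t : 0 < t -> exists2 r, 0 < r & psi r = t.
Proof.
move=> t0; have d1 := d_gt0 (ler01 : 0 <= 1 :> R); have d0 := d_gt0 (lexx 0).
pose g r := d r - t * r.
pose a := Num.min 1 (d 1 / (2 * t)); pose b := d 0 / t + 1.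
have a0 : 0 < a by rewrite lt_min ltr01 divr_gt0 ?mulr_gt0.
have a1 : a <= 1 by rewrite ge_min lexx.
have b1 : 1 <= b by rewrite lerDr divr_ge0 ?ltW.
have ga : 0 <= g a.
  rewrite subr_ge0; apply: le_trans (d_nonincreasing (ltW a0) a1).
  rewrite mulrC -ler_pdivlMr//; apply: (@le_trans _ _ (d 1 / (2 * t))).
    by rewrite ge_min lexx orbT.
  rewrite ler_pM2l// lef_pV2 ?posrE ?mulr_gt0//.
  by rewrite ler_peMl ?(ltW t0)// ler1n.
have gb : g b <= 0.
  rewrite subr_le0; apply: le_trans (d_nonincreasing (lexx 0) (le_trans ler01 b1)) _.
  by rewrite mulrDr mulr1 mulrC divfK ?gt_eqF// lerDl ltW.
have cg : {within `[a, b], continuous g}.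
  apply: continuous_in_subspaceT => r; rewrite inE/= in_itv/= => /andP[ar _].
  apply: cvgB; first exact: d_continuous (lt_le_trans a0 ar).
  by apply: cvgM; [exact: cvg_cst|exact: cvg_id].
have [|r] := IVT (le_trans a1 b1) cg (v := 0).
  by rewrite ge_min gb orbT le_max ga.
rewrite in_itv/= => /andP[ar _] /eqP; rewrite subr_eq0 => /eqP dr.
have r0 : 0 < r by exact: lt_le_trans ar.
by exists r => //; rewrite /psi dr mulfK ?gt_eqF.
Qed.

Let rinvP t : 0 < t -> 0 < rinv t /\ psi (rinv t) = t.
Proof.
move=> t0; have [r r0 rt] := psi_surjective t0.
have surj : set_surj `]0, +oo[ `]0, +oo[ psi.
  move=> s /=; rewrite in_itv/= andbT => /psi_surjective[q q0 qs].
  by exists q => //=; rewrite in_itv/= andbT.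
have tin : t \in `]0, +oo[%classic by rewrite inE/= in_itv/= andbT.
split; last exact: (surjpK _ surj tin).
have : `]0, +oo[%classic (rinv t).
  by apply: (surjpinv_image_sub (dflt := fun=> 0) surj); exists t => //;
    exact: set_mem tin.
by rewrite /= in_itv/= andbT.
Qed.

Let rinv_gt r t : 0 < r -> 0 < t -> t < psi r -> r < rinv t.
Proof.
move=> r0 t0 tr; have [q0 qt] := rinvP t0; rewrite ltNge le_eqVlt.
apply/negP => /orP[/eqP qr|/(psi_decreasing q0)].
  by move: tr; rewrite -qr qt ltxx.
by rewrite qt => /(lt_trans tr); rewrite ltxx.
Qed.

Let rinv_decreasing s t : 0 < s -> s < t -> rinv t < rinv s.
Proof.
move=> s0 st; have t0 := lt_trans s0 st; have [q0 qt] := rinvP t0.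
by apply: rinv_gt => //; rewrite qt.
Qed.

Let phiE t : 0 < t -> phi t = t * rinv t.
Proof.
move=> t0; have [r0 rt] := rinvP t0.
by rewrite -[X in _ = X * _]rt /psi divfK ?gt_eqF.
Qed.

Lemma rate_gt0 t : 0 < t -> 0 < phi t.
Proof. by move=> /rinvP[r0 _]; rewrite d_gt0// ltW. Qed.

Lemma rate_increasing s t : 0 < s -> s < t -> phi s < phi t.
Proof.
move=> s0 st; have [r0 _] := rinvP (lt_trans s0 st).
by apply: convex_vanishing_decreasing (ltW r0) _; exact: rinv_decreasing.
Qed.

(** [phi t / t] is the radius that balances [d r / r = t], and it decreases
    with [t]. *)
Lemma rate_scale s l : 0 < s -> 1 <= l -> phi (l * s) <= l * phi s.
Proof.
move=> s0; rewrite le_eqVlt => /orP[/eqP<-|l1]; first by rewrite !mul1r.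
have l0 : 0 < l := lt_trans ltr01 l1.
rewrite !phiE ?mulr_gt0// mulrA ler_pM2l ?mulr_gt0//.
by apply/ltW/rinv_decreasing => //; rewrite ltr_pMl.
Qed.

(** The radius at which the approximation error [d r] and the price [r t] of a
    residual [t] coincide. *)
Lemma rate_radius t : 0 < t -> exists r, [/\ 0 < r, d r = phi t & r * t = phi t].
Proof.
by move=> t0; exists (rinv t); have [r0 _] := rinvP t0; split=> //; rewrite mulrC phiE.
Qed.

(** Continuity comes from monotonicity and [rate_scale] alone: for [s > t / 2]
    they give [|phi t - phi s| <= |t - s| (2 phi t / t)]. *)
Lemma rate_index : index_function phi.
Proof.
split; [exact: rate_gt0| |exact: rate_increasing|].
- move=> t; rewrite in_itv/= andbT => t0; apply/cvgrPdist_lt => e e0.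
  have pt := rate_gt0 t0.
  have bound s : t / 2 < s -> `|phi t - phi s| <= `|t - s| * (2 * phi t / t).
    move=> ts; have s0 : 0 < s by apply: lt_trans ts; rewrite divr_gt0.
    have ps := rate_gt0 s0.
    case: (ltgtP s t) => [st|ts'|->]; last by rewrite !subrr normr0 mul0r.
    + have /ltW pst := rate_increasing s0 st.
      rewrite !ger0_norm ?subr_ge0 ?(ltW st)//.
      have := @rate_scale s (t / s) s0; rewrite divfK ?gt_eqF//.
      rewrite ler_pdivlMr// mul1r => /(_ (ltW st)) h.
      apply: (@le_trans _ _ ((t - s) * (phi t / s))).
        have -> : (t - s) * (phi t / s) = t / s * phi t - phi t by field; rewrite gt_eqF.
        have : 0 <= (t / s - 1) * (phi t - phi s).
          by rewrite mulr_ge0 ?subr_ge0// ler_pdivlMr// mul1r ltW.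
        lra.
      rewrite ler_wpM2l ?subr_ge0 ?(ltW st)// [2 * _]mulrC -mulrA ler_pM2l//.
      rewrite -(invrK 2) -invfM lef_pV2 ?posrE ?divr_gt0//.
        by rewrite mulrC ltW.
      by rewrite mulr_gt0// invr_gt0.
    + have /ltW pst := rate_increasing t0 ts'.
      rewrite distrC (distrC t) !ger0_norm ?subr_ge0 ?(ltW ts')//.
      have := @rate_scale t (s / t) t0; rewrite divfK ?gt_eqF//.
      rewrite ler_pdivlMr// mul1r => /(_ (ltW ts')) h.
      apply: (@le_trans _ _ ((s - t) * (phi t / t))).
        have -> : (s - t) * (phi t / t) = s / t * phi t - phi t by field; rewrite gt_eqF.
        lra.
      rewrite ler_wpM2l ?subr_ge0 ?(ltW ts')// ler_pM2r ?invr_gt0//.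
      by rewrite ler_peMl ?(ltW pt)// ler1n.
  have c0 : 0 < 2 * phi t / t by rewrite divr_gt0 ?mulr_gt0.
  near=> s; apply: le_lt_trans (bound s _) _.
    by near: s; apply: (cvgr_gt t) => //; rewrite ltr_pdivrMr// ltr_pMr// ltr1n.
  rewrite -ltr_pdivlMr//; near: s; apply: cvgr_dist_lt => //.
  exact: divr_gt0.
- apply/cvgrPdist_lt => e e0; have [r r0 dr] := d_vanishes e0.
  near=> t; have t0 : 0 < t by near: t; exact: nbhs_right_gt.
  rewrite sub0r normrN gtr0_norm ?rate_gt0//; apply: le_lt_trans dr.
  apply: d_nonincreasing; first exact: ltW.
  apply/ltW/rinv_gt => //; near: t; apply: nbhs_right_lt.
  by rewrite divr_gt0 ?d_gt0// ltW.
Unshelve. all: by end_near. Qed.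

Lemma rate_sublinear : sublinear_rate phi.
Proof.
apply/cvgrPdist_lt => e e0; near=> t.
have t0 : 0 < t by near: t; exact: nbhs_right_gt.
have [r0 _] := rinvP t0.
rewrite sub0r normrN phiE// invfM mulrA divff ?gt_eqF// mul1r.
rewrite gtr0_norm ?invr_gt0// -[e]invrK ltf_pV2 ?posrE ?invr_gt0//.
apply: rinv_gt => //; rewrite ?invr_gt0//; near: t; apply: nbhs_right_lt.
by rewrite divr_gt0 ?invr_gt0// d_gt0// invr_ge0 ltW.
Unshelve. all: by end_near. Qed.

End RateFunction.

(** * Sparsity *)

Section SparseNorms.
Context {R : realType}.
Implicit Types (x : nat -> R).
Local Open Scope ereal_scope.

Let nneseries_truncate (f : nat -> R) n :
    (forall i, (0 <= f i)%R) -> (forall i, (n <= i)%N -> f i = 0%R) ->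
  \sum_(i <oo) (f i)%:E = (\sum_(0 <= i < n) f i)%:E.
Proof.
move=> f0 fn; rewrite (@nneseries_split _ _ 0 n)//.
  by rewrite add0n eseries0 ?adde0 ?sumEFin// => i ni _; rewrite fn.
by move=> k _; rewrite lee_fin.
Qed.

Lemma l1_norm_finite x n : (forall i, (n <= i)%N -> x i = 0%R) ->
  l1_norm x = (\sum_(0 <= i < n) `|x i|)%:E.
Proof. by move=> xn; apply: nneseries_truncate => // i ni; rewrite xn// normr0. Qed.

Lemma l0_norm_finite x n : (forall i, (n <= i)%N -> x i = 0%R) ->
  l0_norm x = (\sum_(0 <= i < n) Num.sg `|x i|)%:E.
Proof.
move=> xn; apply: nneseries_truncate => [i|i ni]; first by rewrite sgr_ge0.
by rewrite xn// normr0 sgr0.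
Qed.

Lemma l0_norm_ge0 x : 0 <= l0_norm x.
Proof. by apply: nneseries_ge0 => i _ _; rewrite lee_fin sgr_ge0. Qed.

(** The terms are [0] or [1] and the tails of the sum tend to [0]. *)
Lemma l0_norm_lty x : l0_norm x < +oo ->
  exists n, forall i, (n <= i)%N -> x i = 0%R.
Proof.
have sg0 i : 0 <= (Num.sg `|x i|)%:E by rewrite lee_fin sgr_ge0.
move=> /nneseries_tail_cvg tail.
have /fine_cvgP[tfin tcvg] := tail (fun i _ => sg0 i).
have [n _ nP] : \forall n \near \oo, \sum_(n <= k <oo) (Num.sg `|x k|)%:E < 1.
  have t1 := cvgr_lt _ tcvg _ ltr01.
  near=> n; have nf : \sum_(n <= k <oo) (Num.sg `|x k|)%:E \is a fin_num by near: n.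
  by rewrite -(fineK nf) lte_fin; near: n; exact: t1.
exists n => i ni; apply/eqP; apply: contraT => xi0.
have := nP i ni; rewrite ltNge => /negP[].
have := @nneseries_lim_ge R (fun k => (Num.sg `|x k|)%:E) xpredT i i.+1
  (fun k _ _ => sg0 k).
by rewrite big_nat1 gtr0_sg ?normr_gt0.
Unshelve. all: by end_near. Qed.

Lemma in_l0_bound x : in_l0 x -> exists n, forall i, (n <= i)%N -> x i = 0%R.
Proof.
move=> /finite_seqP[s sE]; exists (\max_(i <- s) i).+1 => i.
apply: contraTeq => xi; rewrite -leqNgt.
apply: leq_bigmax_seq => //.
by have : seq_support x i by []; rewrite sE.
Qed.

End SparseNorms.

Section SparsityInequality.
Context {R : realType} {Y : normedModType R}.
Variables (A : {linear l2 R -> Y}) (Astar : dual_space Y -> l2 R).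
Hypothesis adj : is_adjoint A Astar.
Hypothesis unit_source : forall i, exists w : dual_space Y, unit_seq i = Astar w.

Let coord_bound i : exists2 M : R, 0 <= M & forall z : l2 R, `|z i| <= M * `|A z|.
Proof.
have [w wE] := unit_source i; exists (dual_norm w); first exact: dual_norm_ge0.
by move=> z; rewrite -inner_unit_seq innerC wE adj dual_normP.
Qed.

(** The inequality holds coordinate by coordinate, with
    [K (sg |x i| - sg |xdag i|) + c i t] on the right.  Off the support of
    [xdag] one has [|x i| <= K sg |x i|].  On the support
    [|x i - xdag i| <= M i t], which suffices if [x i] is nonzero; if [x i]
    vanishes the first term is [- K], and [|xdag i| <= M i t] makes it at least
    [- K M i t / |xdag i|], whence the choice of [c i]. *)
Lemma sparsity_inequality (xdag : l2 R) (K : R) : in_l0 xdag -> 0 < K ->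
  exists2 C : R, 0 <= C & forall x : l2 R, (l0_norm x < +oo)%E -> `|x| <= K ->
    (l1_norm (x - xdag)%R <= (K * (fine (l0_norm x) - fine (l0_norm xdag)) +
       C * `|A x - A xdag|)%:E)%E.
Proof.
move=> /in_l0_bound[n0 xd0] K0.
have /choice[M MP] i : exists M : R, 0 <= M /\ forall z : l2 R, `|z i| <= M * `|A z|.
  by have [M ? ?] := coord_bound i; exists M.
pose c i := if xdag i == 0 then 0 else M i * (1 + K / `|xdag i|).
have c0 i : 0 <= c i.
  rewrite /c; case: ifP => // _.
  by rewrite mulr_ge0 ?(MP i).1// addr_ge0// divr_ge0// ltW.
exists (\sum_(0 <= i < n0) c i); first exact: sumr_ge0.
move=> x /l0_norm_lty[n1 x0] xK.
pose n := maxn n0 n1; pose t := `|A x - A xdag|.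
have {}x0 i : (n <= i)%N -> x i = 0.
  by move=> ni; apply/x0/(leq_trans (leq_maxr _ _) ni).
have xdn i : (n <= i)%N -> xdag i = 0.
  by move=> ni; apply/xd0/(leq_trans (leq_maxl _ _) ni).
rewrite (@l1_norm_finite _ _ n); last first.
  by move=> i ni; rewrite l2_addE l2_oppE x0// xdn// subr0.
rewrite (l0_norm_finite x0) (l0_norm_finite xdn) /= lee_fin.
have -> : \sum_(0 <= i < n0) c i = \sum_(0 <= i < n) c i.
  rewrite (@big_cat_nat _ _ _ n0 0 n) ?leq_maxl//= [X in _ = _ + X]big1_seq ?addr0//.
  by move=> i /andP[_]; rewrite mem_index_iota => /andP[ni _]; rewrite /c xd0// eqxx.
rewrite -sumrB mulr_sumr mulr_suml -big_split/=.
apply: ler_sum => i _; rewrite -[leLHS]/(`|x i - xdag i|).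
have xi : `|x i - xdag i| <= M i * t.
  by have := (MP i).2 (x - xdag); rewrite l2_addE l2_oppE linearB.
rewrite /c; case: eqVneq => [xdi|xdi].
  rewrite xdi subr0 normr0 sgr0 subr0 mul0r addr0.
  have [->|xi0] := eqVneq (x i) 0; first by rewrite normr0 sgr0 mulr0.
  by rewrite gtr0_sg ?normr_gt0// mulr1 (le_trans (l2_coord_le x i)).
have axd : 0 < `|xdag i| by rewrite normr_gt0.
rewrite [Num.sg `|xdag i|]gtr0_sg//.
have [xi0|xi0] := eqVneq (x i) 0.
  rewrite xi0 normr0 sgr0 !sub0r normrN mulrN1.
  rewrite xi0 sub0r normrN in xi.
  have -> : M i * (1 + K / `|xdag i|) * t = M i * t + K * (M i * t / `|xdag i|).
    by field; rewrite gt_eqF.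
  have : K * 1 <= K * (M i * t / `|xdag i|) by rewrite ler_pM2l// ler_pdivlMr// mul1r.
  lra.
rewrite gtr0_sg ?normr_gt0// subrr mulr0 add0r mulrDr mulr1 mulrDl.
apply: le_trans xi _; rewrite lerDl mulr_ge0// mulr_ge0 ?(MP i).1//.
by rewrite divr_ge0// ltW.
Qed.

End SparsityInequality.

(** * Convergence rates *)

(** Since [q > 1], the left-hand power outgrows every affine function; for
    [l >= 2] the inequality reduces to [l^(q-1) <= 2^q (1 + D)]. *)
Lemma superlinear_bound (R : realType) (q D : R) : 1 < q -> 0 <= D ->
  exists2 L : R, 1 <= L &
    forall l, 1 <= l -> (l - 1) `^ q <= 1 + D * l -> l <= L.
Proof.
move=> q1 D0; have q0 : 0 < q := lt_trans ltr01 q1.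
pose B := 2 `^ q * (1 + D).
exists (Num.max 2 (B `^ (q - 1)^-1)); first by rewrite le_max ler1n.
move=> l l1 lq; rewrite le_max; have [//|l2] := leP l 2.
have l0 : 0 < l := lt_le_trans ltr01 l1.
have h : (l / 2) `^ q <= (1 + D) * l.
  apply: (@le_trans _ _ ((l - 1) `^ q)); last first.
    by apply: le_trans lq _; rewrite mulrDl mul1r lerD2r.
  rewrite ge0_ler_powR ?nnegrE ?subr_ge0 ?(ltW q0) ?divr_ge0 ?(ltW l0)//.
  lra.
have lB : l `^ (q - 1) <= B.
  rewrite -(ler_pM2r l0) -{2}(powRr1 (ltW l0)) -powRD; last first.
    by rewrite subrK gt_eqF// implybT.
  rewrite subrK /B -mulrA -{1}(divfK (_ : 2 != 0 :> R) l)// mulrC.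
  by rewrite powRM ?divr_ge0 ?(ltW l0)// ler_pM2l ?powR_gt0.
have q10 : 0 < q - 1 by rewrite subr_gt0.
have -> : l = (l `^ (q - 1)) `^ (q - 1)^-1.
  by rewrite -powRrM divff ?gt_eqF// powRr1// ltW.
have B0 : 0 <= B by rewrite mulr_ge0 ?powR_ge0 ?addr_ge0.
by rewrite ge0_ler_powR ?nnegrE ?powR_ge0 ?invr_ge0 ?(ltW q10) ?orbT.
Qed.

Section ConvergenceRate.
Context {R : realType} {Y : normedModType R}.
Variables (A : {linear l2 R -> Y}) (Astar : dual_space Y -> l2 R).
Variables (Reg : l2 R -> \bar R) (xdag xi : l2 R).
Hypothesis adj : is_adjoint A Astar.
Hypothesis unit_source : forall i, exists w : dual_space Y, unit_seq i = Astar w.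
Hypothesis Reg_ge0 : forall x, (0 <= Reg x)%E.
Hypothesis Reg_stabilizing : stabilizing Reg.
Hypothesis xdag_sparse : in_l0 xdag.
Hypothesis xi_subdiff : subdifferential Reg xdag xi.
Hypothesis xi_no_source : ~ exists w, xi = Astar w.

Let d := distance_function Astar xi.
Let phi := rate_function Astar xi.
Let J x := fine (Omega Reg x).

Let d_gt0 r : 0 <= r -> 0 < d r.
Proof. by move=> r0; exact: (distance_gt0 adj). Qed.

Let d_nonincreasing r s : 0 <= r -> r <= s -> d s <= d r.
Proof. exact: (distance_nonincreasing adj). Qed.

Let d_convex (t r s : R) : 0 <= t <= 1 -> 0 <= r -> 0 <= s ->
  d (t * r + (1 - t) * s) <= t * d r + (1 - t) * d s.
Proof. exact: (distance_convex adj). Qed.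

Let d_vanishes e : 0 < e -> exists2 r, 0 < r & d r < e.
Proof. exact: (distance_vanishes adj). Qed.

Let phi_gt0 t : 0 < t -> 0 < phi t.
Proof. exact: (rate_gt0 d_gt0 d_nonincreasing d_convex). Qed.

Let phi_scale s l : 0 < s -> 1 <= l -> phi (l * s) <= l * phi s.
Proof. exact: (rate_scale d_gt0 d_nonincreasing d_convex). Qed.

Let phi_nondecreasing s t : 0 < s -> s <= t -> phi s <= phi t.
Proof.
move=> s0; rewrite le_eqVlt => /orP[/eqP-> //|st].
exact/ltW/(rate_increasing d_gt0 d_nonincreasing d_convex d_vanishes).
Qed.

Let phi_radius t : 0 < t -> exists r, [/\ 0 < r, d r = phi t & r * t = phi t].
Proof. exact: (rate_radius d_gt0 d_nonincreasing d_convex). Qed.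

Lemma rate_function_index : index_function phi.
Proof. exact: (rate_index d_gt0 d_nonincreasing d_convex d_vanishes). Qed.

Lemma rate_function_sublinear : sublinear_rate phi.
Proof. exact: (rate_sublinear d_gt0 d_nonincreasing d_convex). Qed.

Let Omega_ge0 x : (0 <= Omega Reg x)%E.
Proof. by rewrite adde_ge0 ?l0_norm_ge0. Qed.

Let OmegaE x : (Omega Reg x < +oo)%E -> Omega Reg x = (J x)%:E.
Proof. by move=> Ox; rewrite /J fineK// ge0_fin_numE. Qed.

Lemma Omega_lty x : (Omega Reg x < +oo)%E ->
  [/\ l0_norm x \is a fin_num, Reg x \is a fin_num &
      J x = fine (l0_norm x) + fine (Reg x)].
Proof.
move=> Ox; have l0 := l0_norm_ge0 x; have R0 := Reg_ge0 x.
have lf : l0_norm x \is a fin_num.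
  by rewrite ge0_fin_numE//; apply: le_lt_trans Ox; rewrite leeDl.
have rf : Reg x \is a fin_num.
  by rewrite ge0_fin_numE//; apply: le_lt_trans Ox; rewrite leeDr.
by split=> //; rewrite /J /Omega fineD.
Qed.

Lemma Omega_xdag_lty : (Omega Reg xdag < +oo)%E.
Proof.
rewrite /Omega lte_add_pinfty//; last by case: xi_subdiff.
by have [n xn] := in_l0_bound xdag_sparse; rewrite (l0_norm_finite xn) ltry.
Qed.

(** The factor [2] and the summand [1] are the prices of the approximation of
   [xi], where a near-minimizer at distance less than [2 d r] is used, and of the
   residual. *)
Let Reg_lower_bound K x t : (Reg x < +oo)%E -> `|x| <= K -> 0 < t ->
  `|A x - A xdag| <= t ->
  fine (Reg xdag) - fine (Reg x) <= (2 * (K + `|xdag|) + 1) * phi t.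
Proof.
move=> Rx xK t0 xt; have [r [r0 dr rt]] := phi_radius t0.
have p0 := phi_gt0 t0.
have [w wr we] := distance_adherent adj xi (ltW r0) (phi_gt0 t0).
rewrite -/d dr in we.
have rf : Reg x \is a fin_num by rewrite ge0_fin_numE.
have [xd sub] := xi_subdiff.
have rdf : Reg xdag \is a fin_num by rewrite ge0_fin_numE.
have := sub x; rewrite -(fineK rf) -(fineK rdf) -EFinD lee_fin => sx.
have split_xi : inner xi (x - xdag) = inner (xi - Astar w) (x - xdag) + w (A x - A xdag).
  by rewrite -linearB -adj -innerDl subrK.
have nx : `|x - xdag| <= K + `|xdag|.
  by apply: le_trans (ler_normB _ _) _; rewrite lerD2r.
have i1 : `|inner (xi - Astar w) (x - xdag)| <= 2 * phi t * (K + `|xdag|).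
  apply: le_trans (inner_norm_le _ _) _; rewrite ler_pM// (le_trans (ltW we))//.
  by rewrite mulr_natl mulr2n.
have i2 : `|w (A x - A xdag)| <= phi t.
  apply: le_trans (dual_normP _ _) _; rewrite -rt.
  by rewrite ler_pM// dual_norm_ge0.
move: sx i1 i2; rewrite split_xi !ler_norml => sx /andP[i1 _] /andP[i2 _].
lra.
Qed.

(** The sublevel set enters through a bound [K] on the norms, obtained from the
    stabilizing property of [Reg].  Allowing residuals up to [l delta] with
    [l >= 1] keeps the dependence on the residual linear, by [rate_scale]; terms
    linear in the residual are absorbed because
    [phi 1 <= delta^-1 phi(delta)]. *)
Lemma variational_inequality (c : R) : exists b C : R, [/\ 0 < b, 0 <= C &
  forall x, (Omega Reg x <= c%:E)%E -> forall delta l : R,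
    0 < delta <= 1 -> 1 <= l -> `|A x - A xdag| <= l * delta ->
    (l1_norm (x - xdag)%R <= (b * (J x - J xdag) + C * l * phi delta)%:E)%E].
Proof.
have p1 := phi_gt0 ltr01.
have [c0|c0] := ltP c 0.
  exists 1, 0; split=> // x Ox; exfalso.
  by have := le_trans (Omega_ge0 x) Ox; rewrite lee_fin leNgt c0.
have [K0 K0P] := weakly_seq_precompact_bounded (Reg_stabilizing c0).
pose K := Num.max 1 K0; have K_gt0 : 0 < K by rewrite lt_max ltr01.
have [C0 C0_ge0 sparse] := sparsity_inequality adj unit_source xdag_sparse K_gt0.
have D0 : 0 <= K * (2 * (K + `|xdag|) + 1).
  by rewrite mulr_ge0 ?(ltW K_gt0)// addr_ge0// mulr_ge0// addr_ge0// ltW.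
exists K, (K * (2 * (K + `|xdag|) + 1) + C0 / phi 1); split=> //.
  by rewrite addr_ge0// divr_ge0// ltW.
move=> x Ox delta l /andP[delta0 delta1] l1 xt.
have l0 : 0 < l := lt_le_trans ltr01 l1.
have Oxy : (Omega Reg x < +oo)%E by apply: le_lt_trans Ox _; rewrite ltry.
have [lf rf JE] := Omega_lty Oxy; have [ldf rdf JdE] := Omega_lty Omega_xdag_lty.
have Rx : (Reg x <= c%:E)%E by apply: le_trans Ox; rewrite leeDr// l0_norm_ge0.
have xK : `|x| <= K by rewrite le_max (K0P x Rx) orbT.
have lx : (l0_norm x < +oo)%E by rewrite -ge0_fin_numE// l0_norm_ge0.
apply: le_trans (sparse x lx xK) _; rewrite lee_fin JE JdE.
have t0 : 0 < l * delta by rewrite mulr_gt0.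
have Rlow := Reg_lower_bound (le_lt_trans Rx (ltry c)) xK t0 xt.
have pl := phi_scale delta0 l1.
have dp : delta <= phi delta / phi 1.
  rewrite ler_pdivlMr// mulrC -ler_pdivlMr// mulrC.
  have := @phi_scale delta delta^-1 delta0; rewrite mulVf ?gt_eqF//; apply.
  by rewrite invf_ge1.
have h1 : C0 * `|A x - A xdag| <= C0 / phi 1 * l * phi delta.
  have -> : C0 / phi 1 * l * phi delta = C0 * (l * (phi delta / phi 1)) by ring.
  by rewrite ler_wpM2l// (le_trans xt)// ler_pM2l.
have h2 : K * (fine (Reg xdag) - fine (Reg x)) <=
    K * (2 * (K + `|xdag|) + 1) * l * phi delta.
  apply: (@le_trans _ _ (K * ((2 * (K + `|xdag|) + 1) * phi (l * delta)))).
    by rewrite ler_pM2l.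
  by rewrite mulrA -[leRHS]mulrA ler_wpM2l.
lra.
Qed.

Section Minimizers.
Variables (q : R) (y : Y).
Hypothesis q_gt1 : 1 < q.
Hypothesis xdag_solution : A xdag = y.

Let q_gt0 : 0 < q. Proof. exact: lt_trans q_gt1. Qed.

Let residual_le yd delta z : `|y - yd| <= delta ->
  `|A z - A xdag| <= `|A z - yd| + delta.
Proof.
move=> yyd; rewrite xdag_solution -[A z - y](subrKA yd).
by apply: le_trans (ler_normD _ _) _; rewrite lerD2l distrC.
Qed.

Lemma minimizer_inequality (yd : Y) (xs : R -> l2 R) (delta alpha : R) :
  `|y - yd| <= delta -> regularized A Reg q yd xs -> 0 < alpha ->
  (Omega Reg (xs alpha) < +oo)%E /\
  `|A (xs alpha) - yd| `^ q + q * alpha * (J (xs alpha) - J xdag) <= delta `^ q.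
Proof.
move=> yyd reg alpha0; have := reg alpha alpha0 xdag; set x := xs alpha.
rewrite /tikhonov xdag_solution.
rewrite (OmegaE Omega_xdag_lty) -EFinM -EFinD => xmin.
have Ox : (Omega Reg x < +oo)%E.
  rewrite ltey; apply/eqP => xoo; move: xmin; rewrite xoo.
  by rewrite gt0_muley ?lte_fin// addey// leye_eq.
split=> //; move: xmin; rewrite (OmegaE Ox) -EFinM -EFinD lee_fin => xmin.
have yq : `|y - yd| `^ q <= delta `^ q.
  by rewrite ge0_ler_powR// ?nnegrE ?(ltW q_gt0)// (le_trans _ yyd).
have : q * (q^-1 * `|A x - yd| `^ q + alpha * J x) <=
    q * (q^-1 * `|y - yd| `^ q + alpha * J xdag) by rewrite ler_pM2l.
rewrite !mulrDr !mulrA divff ?gt_eqF// !mul1r.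
lra.
Qed.

Let near0_unit : \forall delta \near (0 : R)^'+, 0 < delta <= 1.
Proof.
near=> delta; apply/andP; split.
  by near: delta; exact: nbhs_right_gt.
by near: delta; exact: nbhs_right_le.
Unshelve. all: by end_near. Qed.

(** The gap is at most [phi(delta)] at once; the growth bound is needed to keep
    the residual, hence the factor [l], bounded. *)
Lemma a_priori_rate :
  l1_convergence_rate A Reg q y xdag (a_priori_choice q phi) phi.
Proof.
have [b [C [b0 C0 VI]]] := variational_inequality (J xdag + phi 1).
have D0 : 0 <= q * (C / b) by rewrite mulr_ge0 ?(ltW q_gt0)// divr_ge0// ltW.
have [L L1 LP] := superlinear_bound q_gt1 D0.
exists (b + C * L); apply: filterS near0_unit => delta /andP[delta0 delta1].
move=> yd xs alpha yyd reg alphaE.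
have p0 := phi_gt0 delta0; have dq0 := powR_gt0 q delta0.
have alpha0 : 0 < alpha by rewrite alphaE divr_gt0.
have [Ox min] := minimizer_inequality yyd reg alpha0.
set x := xs alpha in Ox min *.
pose s := `|A x - yd|; pose t := `|A x - A xdag|; rewrite -/s in min.
have qa0 : 0 < q * alpha by rewrite mulr_gt0.
have dqE : delta `^ q = alpha * phi delta by rewrite alphaE divfK ?gt_eqF.
have Jx : J x - J xdag <= phi delta.
  rewrite -(ler_pM2l qa0); apply: (@le_trans _ _ (delta `^ q)).
    by apply: le_trans min; rewrite lerDr powR_ge0.
  by rewrite dqE -mulrA ler_peMl ?mulr_ge0 ?ltW.
have Oc : (Omega Reg x <= (J xdag + phi 1)%:E)%E.
  rewrite (OmegaE Ox) lee_fin -lerBlDl; apply: le_trans Jx _.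
  exact: phi_nondecreasing.
pose l := Num.max 1 (t / delta).
have l1 : 1 <= l by rewrite le_max lexx.
have tl : t <= l * delta by rewrite -ler_pdivrMr// le_max lexx orbT.
have main := VI x Oc delta l.
rewrite delta0 delta1 in main; have {}main := main isT l1 tl.
(* The l^1 norm being nonnegative, the variational inequality also bounds the
   gap from below. *)
have lower : 0 <= b * (J x - J xdag) + C * l * phi delta.
  by rewrite -lee_fin; apply: le_trans main; apply: nneseries_ge0.
have ts : t <= s + delta by exact: residual_le.
have ls : (l - 1) * delta <= s.
  rewrite mulrBl mul1r lerBlDr -ler_pdivlMr// ge_max; apply/andP; split.
    by rewrite ler_pdivlMr// mul1r lerDr normr_ge0.
  by rewrite ler_pM2r ?invr_gt0.
have lL : l <= L.
  apply: LP => //; rewrite -(ler_pM2r dq0) -powRM ?subr_ge0 ?(ltW delta0)//.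
  apply: (@le_trans _ _ (s `^ q)).
    by rewrite ge0_ler_powR ?nnegrE ?(ltW q_gt0) ?normr_ge0 ?mulr_ge0
      ?subr_ge0 ?(ltW delta0).
  have : q * alpha / b * (b * (J x - J xdag) + C * l * phi delta) >= 0.
    by rewrite mulr_ge0// divr_ge0 ?ltW.
  rewrite mulrDr mulrA divfK ?gt_eqF//.
  have -> : (1 + q * (C / b) * l) * delta `^ q =
      delta `^ q + q * alpha / b * (C * l * phi delta) by rewrite dqE; ring.
  lra.
apply: le_trans main _; rewrite lee_fin mulrDl lerD// ?ler_pM2l//.
by rewrite ler_pM2r// ler_wpM2l.
Qed.

(** The minimizer for the rejected parameter [alpha'] does not exceed [xdag] in
    [Omega], because its residual exceeds [delta].  With residual [l delta], where
    [l > tau], the variational inequality bounds from below how far [Omega] can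
    fall under its value at [xdag], so that
    [(l^q - 1) delta^q] is at most a multiple of [alpha' l phi(delta)]; as
    [l^q - 1 >= l - 1 >= l (1 - 1 / tau)], the factor [l] cancels. *)
Lemma discrepancy_rate (alpha0 nu tau : R) :
  0 < alpha0 -> 0 < nu < 1 -> 1 < tau ->
  l1_convergence_rate A Reg q y xdag (discrepancy_principle A alpha0 nu tau) phi.
Proof.
move=> alpha0_gt0 /andP[nu0 nu1] tau1; have tau0 : 0 < tau := lt_trans ltr01 tau1.
have [b1 [C1 [b1_gt0 C1_ge0 VI1]]] := variational_inequality (J xdag).
have k0 : 0 < 1 - tau^-1 by rewrite subr_gt0 invf_lt1.
pose C3 := 2 * C1 / b1 / (nu * (1 - tau^-1)).
have C3_ge0 : 0 <= C3.
  by rewrite divr_ge0 ?mulr_ge0 ?(ltW nu0) ?(ltW k0) ?invr_ge0 ?(ltW b1_gt0).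
(* A second sublevel set: the minimizer for the accepted parameter may lie
   above [J xdag], by at most [C3 * phi delta]. *)
have [b2 [C2 [b2_gt0 C2_ge0 VI2]]] := variational_inequality (J xdag + C3 * phi 1).
exists (b2 * C3 + C2 * (tau + 1)).
apply: filterS near0_unit => delta /andP[delta0 delta1].
move=> yd xs alpha yyd reg [[[//]|j [_ alphaE sx sx']]].
rewrite -alphaE in sx.
pose alpha' := nu ^+ j * alpha0; rewrite -/alpha' in sx'.
have alpha'0 : 0 < alpha' by rewrite mulr_gt0 ?exprn_gt0.
have alphaE' : alpha = nu * alpha' by rewrite alphaE exprS mulrA.
have alpha_gt0 : 0 < alpha by rewrite alphaE' mulr_gt0.
have p0 := phi_gt0 delta0; have dq0 := powR_gt0 q delta0.
have step : delta `^ q * (1 - tau^-1) <= q * alpha' * (2 * C1 / b1) * phi delta.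
  have [Ox min] := minimizer_inequality yyd reg alpha'0.
  set x := xs alpha' in Ox min sx'; pose s := `|A x - yd|; rewrite -/s in min sx'.
  pose l := s / delta.
  have sl : s = l * delta by rewrite /l divfK ?gt_eqF.
  have lt : tau < l by rewrite /l ltr_pdivlMr.
  have l1 : 1 < l := lt_trans tau1 lt.
  have l0 : 0 < l := lt_trans ltr01 l1.
  have llq : l <= l `^ q.
    by rewrite -{1}(powRr1 (ltW l0)) ler_powR ?(ltW l1)// ltW.
  rewrite sl powRM ?(ltW l0) ?(ltW delta0)// in min.
  have E1 : q * alpha' * (J x - J xdag) <= delta `^ q - l `^ q * delta `^ q by lra.
  have Jx : J x <= J xdag.
    have qa'0 : 0 < q * alpha' by rewrite mulr_gt0.
    rewrite -subr_le0 -(ler_pM2l qa'0) mulr0.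
    apply: le_trans E1 _; rewrite subr_le0 ler_peMl ?(ltW dq0)//.
    by rewrite (le_trans (ltW l1)).
  have := VI1 x; rewrite OmegaE// lee_fin => /(_ Jx delta (2 * l)).
  have l2 : 1 <= 2 * l by rewrite (le_trans (ltW l1))// ler_peMl ?(ltW l0)// ler1n.
  have xl : `|A x - A xdag| <= 2 * l * delta.
    apply: le_trans (residual_le x yyd) _; rewrite -/s sl.
    have : delta <= l * delta by rewrite ler_peMl ?ltW.
    by lra.
  rewrite delta0 delta1 => /(_ isT l2 xl) main.
  have lower : 0 <= b1 * (J x - J xdag) + C1 * (2 * l) * phi delta.
    by rewrite -lee_fin; apply: le_trans main; apply: nneseries_ge0.
  have : 0 <= q * alpha' / b1 * (b1 * (J x - J xdag) + C1 * (2 * l) * phi delta).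
    by rewrite mulr_ge0// divr_ge0 ?(ltW b1_gt0)// mulr_ge0 ?(ltW q_gt0) ?(ltW alpha'0).
  rewrite mulrDr mulrA divfK ?gt_eqF// => E2.
  have E3 : l * delta `^ q <= l `^ q * delta `^ q by rewrite ler_pM2r.
  have E4 : l * (1 - tau^-1) <= l - 1.
    rewrite mulrBr mulr1 lerD2l lerN2 ler_pdivlMr// mul1r; exact: ltW.
  rewrite -(ler_pM2l l0).
  have E5 : l * (1 - tau^-1) * delta `^ q <= (l - 1) * delta `^ q by rewrite ler_pM2r.
  have -> : l * (delta `^ q * (1 - tau^-1)) = l * (1 - tau^-1) * delta `^ q by ring.
  have -> : l * (q * alpha' * (2 * C1 / b1) * phi delta) =
    q * alpha' / b1 * (C1 * (2 * l) * phi delta) by ring.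
  lra.
have [Ox min] := minimizer_inequality yyd reg alpha_gt0.
set x := xs alpha in Ox min sx *.
have qa0 : 0 < q * alpha by rewrite mulr_gt0.
have Jx : J x - J xdag <= C3 * phi delta.
  rewrite -(ler_pM2l qa0); apply: (@le_trans _ _ (delta `^ q)).
    by apply: le_trans min; rewrite lerDr powR_ge0.
  rewrite -(ler_pM2r k0); apply: le_trans step _.
  rewrite le_eqVlt; apply/orP; left; apply/eqP; rewrite /C3 alphaE'.
  by field; rewrite !gt_eqF// subr_gt0.
have Oc : (Omega Reg x <= (J xdag + C3 * phi 1)%:E)%E.
  rewrite OmegaE// lee_fin -lerBlDl; apply: le_trans Jx _.
  by rewrite ler_wpM2l// phi_nondecreasing.
have tau1' : 1 <= tau + 1 by rewrite lerDr ltW.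
have xt : `|A x - A xdag| <= (tau + 1) * delta.
  by apply: le_trans (residual_le x yyd) _; rewrite mulrDl mul1r lerD2r.
have := VI2 x Oc delta (tau + 1).
rewrite delta0 delta1 => /(_ isT tau1' xt) main.
apply: le_trans main _; rewrite lee_fin mulrDl lerD2r -mulrA.
by rewrite ler_pM2l.
Qed.

End Minimizers.
End ConvergenceRate.

Theorem theorem2 (R : realType) (Y : completeNormedModType R)
  (A : {linear l2 R -> Y}) (Astar : dual_space Y -> l2 R)
  (y : Y) (xdag : l2 R) (Reg : l2 R -> \bar R) (xi : l2 R)
  (q alpha0 nu tau : R)
  (Y_infinite : infinite_dimensional Y)
  (A_bounded : bounded_operator A)
  (A_injective : injective A)
  (A_adjoint : is_adjoint A Astar)
  (A_range : ~ closed (range A))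
  (xdag_solution : A xdag = y)
  (xdag_sparse : in_l0 xdag)
  (xdag_support : seq_support xdag !=set0)
  (Reg_ge0 : forall x, (0 <= Reg x)%E)
  (Reg_proper : proper_functional Reg)
  (Reg_convex : convex_functional Reg)
  (Reg_lsc : lower_semicontinuous Reg)
  (Reg_stabilizing : stabilizing Reg)
  (unit_source : forall i : nat, exists omega : dual_space Y, unit_seq i = Astar omega)
  (xdag_domain : effective_domain Reg xdag)
  (subdiff_nonempty : subdifferential Reg xdag !=set0)
  (source_fails :
    ~ exists2 eta, subdifferential Reg xdag eta & exists w : dual_space Y, eta = Astar w)
  (xi_subdiff : subdifferential Reg xdag xi)
  (q_gt1 : 1 < q)
  (alpha0_gt0 : 0 < alpha0)
  (nu_bounds : 0 < nu < 1)
  (tau_gt1 : 1 < tau) :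
  let phi := rate_function Astar xi in
  [/\ index_function phi,
      sublinear_rate phi,
      l1_convergence_rate A Reg q y xdag (a_priori_choice q phi) phi
    & l1_convergence_rate A Reg q y xdag (discrepancy_principle A alpha0 nu tau) phi].
Proof.
have xi_no_source : ~ exists w, xi = Astar w.
  by move=> [w wE]; apply: source_fails; exists xi => //; exists w.
split.
- exact: (rate_function_index A_adjoint).
- exact: (rate_function_sublinear A_adjoint).
- exact: (a_priori_rate A_adjoint).
- exact: (discrepancy_rate A_adjoint).
Qed.
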